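(* The following identity of $V$-valued logarithmic differential $(k+1)$-forms on $\mathbb C^n\times\mathbb C^k$ holds: $$\sum_{\substack{\text{independent}\\ \{j_1<\dots<j_k\}\subset J}}\Big(\sum_{j\in J}a_j\omega_j\Big)\wedge\omega_{j_1}\wedge\dots\wedge\omega_{j_k}\otimes F(H_{j_1},\dots,H_{j_k})=\sum_{\substack{\text{independent}\\ \{j_1<\dots<j_k\}\subset J}}\ \sum_{C\in\mathfrak C}\omega_C\wedge\omega_{j_1}\wedge\dots\wedge\omega_{j_k}\otimes L_CF(H_{j_1},\dots,H_{j_k}).$$
   Context: Let $0<k<n$ be integers and $J=\{1,\dots,n\}$. Fix nonzero linear functions $g_j=b_j^1t_1+\dots+b_j^kt_k$, $j\in J$, on $\mathbb C^k$ ($b_j^i\in\mathbb C$) spanning the dual space of $\mathbb C^k$, and nonzero complex weights $(a_j)_{j\in J}$. On $\mathbb C^n\times\mathbb C^k$ with coordinates $(z,t)$ put $f_j=z_j+g_j(t)$ and $\omega_j=df_j/f_j$ ($d$ is the differential in both $z$ and $t$). A circuit is a subset $C\subset J$ such that $(g_i)_{i\in C}$ is linearly dependent while every proper subset is linearly independent; $\mathfrak C$ is the set of circuits. For $C\in\mathfrak C$ fix numbers $(\lambda^C_i)_{i\in C}$, not all zero, with $\sum_{i\in C}\lambda_i^Cg_i=0$; put $f_C=\sum_{i\in C}\lambda_i^Cz_i$ and $\omega_C=df_C/f_C$. Call $\{j_1,\dots,j_k\}\subset J$ independent if $g_{j_1},\dots,g_{j_k}$ are linearly independent. $V$ is the complex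 vector space with basis $F(H_{j_1},\dots,H_{j_k})$ labelled by the independent subsets $\{j_1<\dots<j_k\}$ of $J$; for other orderings $F(H_{j_{\sigma(1)}},\dots,H_{j_{\sigma(k)}})=(-1)^{|\sigma|}F(H_{j_1},\dots,H_{j_k})$. For a circuit $C=\{i_1,\dots,i_r\}$ define $L_C:V\to V$ on basis vectors by $L_CF(H_{j_1},\dots,H_{j_k})=0$ if $|\{j_1,\dots,j_k\}\cap C|<r-1$, and, for independent sets containing all elements of $C$ but $i_m$, $$L_CF(H_{i_1},\dots,\widehat{H_{i_m}},\dots,H_{i_r},H_{s_1},\dots,H_{s_{k-r+1}})=(-1)^m\sum_{l=1}^r(-1)^la_{i_l}F(H_{i_1},\dots,\widehat{H_{i_l}},\dots,H_{i_r},H_{s_1},\dots,H_{s_{k-r+1}}).$$ *)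

(* Defs.v *)
From HB Require Import structures.
From mathcomp Require Import all_boot all_order all_fingroup all_algebra.
From mathcomp Require Import all_classical all_reals all_analysis.

Set Implicit Arguments.
Unset Strict Implicit.
Unset Printing Implicit Defensive.

Import Order.TTheory GRing.Theory Num.Theory.
Import numFieldNormedType.Exports.

Local Open Scope ring_scope.

Section DifferentialForms.
Context {K : numFieldType} {E : normedModType K}.

(* A p-form is given by its values on points and p-tuples of tangent vectors. *)
Definition form1 := E -> E -> K.
Definition form (p : nat) := E -> ('I_p -> E) -> K.

Definition dlog (f : E -> K^o) : form1 := fun x u => (f x)^-1 * 'd f x u.

(* (theta_0 /\ ... /\ theta_(p-1)) (v_0, ..., v_(p-1)) = det (theta_i (v_j)),
   so that (alpha /\ beta) (u, v) = alpha u * beta v - alpha v * beta u. *)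
Definition wedge (p : nat) (theta : p.-tuple form1) : form p :=
  fun x v => \det (\matrix_(i, j) tnth theta i x (v j)).

Definition tensor (W : lmodType K) (p : nat) (eta : form p) (w : W)
  (x : E) (v : 'I_p -> E) : W := eta x v *: w.

End DifferentialForms.
Arguments form1 {K} E.
Arguments form {K} E p.

Section Arrangement.
(* The field of complex numbers is the instance K := R[i]. *)
Context {K : numFieldType} {n k : nat}.
Local Notation E := ('rV[K]_n * 'rV[K]_k)%type.
Local Notation dual := 'Hom('rV[K]_k, K^o).
Variable g : 'I_n -> dual.

Definition lin_indep (s : seq 'I_n) : bool := free [seq g i | i <- s].

Definition circuit (D : {set 'I_n}) : bool :=
  ~~ lin_indep (enum D) &&
  [forall (D' : {set 'I_n} | D' \proper D), lin_indep (enum D')].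

Definition ff (j : 'I_n) (x : E) : K^o := x.1 0 j + g j x.2.

Definition omega (j : 'I_n) : form1 E := dlog (ff j).

Definition omega_a (a : 'I_n -> K) : form1 E :=
  fun x u => \sum_(j < n) a j * omega j x u.

(* Only the values of [l] on [D] matter. *)
Definition fcirc (D : {set 'I_n}) (l : 'I_n -> K) (x : E) : K^o :=
  \sum_(i in D) l i * x.1 0 i.

Definition omegac (D : {set 'I_n}) (l : 'I_n -> K) : form1 E :=
  dlog (fcirc D l).

(* The independent subsets {j_1 < ... < j_k}, as increasing k-tuples. *)
Definition indep : finType :=
  {t : k.-tuple 'I_n | sorted [rel i j : 'I_n | (i < j)%N] t && lin_indep t}.

(* theta /\ omega_(j_1) /\ ... /\ omega_(j_k) *)
Definition wedge_omega (theta : form1 E) (A : indep) : form E k.+1 :=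
  wedge [tuple of theta :: [seq omega j | j <- val A]].

Definition flagV := {ffun indep -> K^o}.

(* F(H_{s_1},...,H_{s_k}) for an arbitrary ordering s of an independent set:
   the sign of the ordering times the basis vector of that set. The value is 0
   when s is not an ordering of an independent k-subset. *)
Definition F (s : seq 'I_n) : flagV :=
  [ffun A : indep => \sum_(sigma : 'S_k)
     if s == [seq tnth (val A) (sigma l) | l <- enum 'I_k]
     then (-1) ^+ sigma else 0].

Variable a : 'I_n -> K.

(* L_D on the basis vector F(A), with D = {i_1 < ... < i_r}. If
   #|A :&: D| = r - 1, there is exactly one m in D outside A, and
   F(A) = e * F(D minus m, A minus D) with e = +1 or -1 the coordinate of
   F(D minus m, A minus D) along A. Positions in D are counted from 0, which
   leaves the product of the two signs (-1)^m (-1)^l unchanged. *)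
Definition Lbasis (D : {set 'I_n}) (A : indep) : flagV :=
  let r := #|D| in
  let c := enum D in
  let s := [seq i <- val A | i \notin D] in
  if (#|[set i in val A | i \in D]| < r.-1)%N then 0 else
  \sum_(m in D | m \notin val A)
    F (rem m c ++ s) A *:
      ((-1) ^+ index m c *:
         \sum_(l in D) ((-1) ^+ index l c * a l) *: F (rem l c ++ s)).

Definition L (D : {set 'I_n}) (v : flagV) : flagV :=
  \sum_(A : indep) v A *: Lbasis D A.

End Arrangement.

(* Main.v *)
From HB Require Import structures.
Require Import Defs.
From mathcomp Require Import all_boot all_order all_fingroup all_algebra.
From mathcomp Require Import complex ring.
From mathcomp Require Import all_classical all_reals all_analysis.
Import Order.TTheory GRing.Theory Num.Theory.
Import numFieldNormedType.Exports.
Local Open Scope ring_scope.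
Local Open Scope complex_scope.

(** The identity is checked on each coordinate of V, that is, for each
independent set B one compares the coefficients of F(B).

On the left the coefficient is the sum over l of a_l omega_l /\ omega_B, and
only l outside B contributes, since otherwise omega_l occurs twice.

On the right a circuit D contributes to F(B) through the terms that exchange
some m in D for some l in D: writing c for the increasing list of D and s for
the increasing list of B minus D, the elements of A are those of c minus m and
of s, and the elements of B are those of c minus l and of s. Since f_D
is a linear form in the z_i and the relation of the circuit kills the t-part,
f_D = sum_(i in D) lambda_i f_i, so that
  omega_D = sum_(i in D) (lambda_i f_i / f_D) omega_i,
a combination whose coefficients sum to 1. Wedging with all omega_i of c but
the m-th keeps only the m-th summand, and moving omega_m back to its place in
c costs exactly the sign (-1)^m carried by L_D. Summing over m therefore
replaces omega_D by the full product omega_c /\ omega_s (row_det_circuit), which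
is (-1)^l omega_l /\ omega_(c minus l) /\ omega_s; the sign cancels the other
sign of L_D. So D contributes the sum of a_l omega_l /\ omega_B over those l in D
outside B with D minus l contained in B (circuit_contribution).

Finally B is a basis, so each l outside B lies in exactly one circuit D with
D minus l contained in B (fundamental_circuit and fundamental_circuit_uniq),
and summing over all circuits gives the left-hand side.

At a point and on k+1 tangent vectors a product of k+1 one-forms is the
determinant of the matrix of their values, so signs of reorderings become
row permutations. *)

(** * Determinants with rows listed in a sequence *)

(** Rows come as a sequence so that deleting an element of a circuit and
prepending a one-form are operations on lists. *)
Definition row_det {K : comPzRingType} {m : nat} (q : seq 'rV[K]_m) : K :=
  \det (\matrix_(i < m) nth 0 q i).

Section RowDet.
Context {K : comPzRingType} {m : nat}.
Implicit Types (q : seq 'rV[K]_m.+1) (p : 'rV[K]_m.+1).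

Lemma row_det_perm (sigma : 'S_m.+1) q q' :
  (forall i : 'I_m.+1, nth 0 q' i = nth 0 q (sigma i)) ->
  row_det q' = (-1) ^+ sigma * row_det q.
Proof.
move=> qE; rewrite /row_det -det_perm -det_mulmx -row_permE.
by congr (\det _); apply/matrixP => i j; rewrite !mxE qE.
Qed.

Lemma row_det_dup p q : (size q <= m)%N -> p \in q -> row_det (p :: q) = 0.
Proof.
move=> sz_q p_q; have lt_p : (index p q < m)%N.
  by apply: leq_trans sz_q; rewrite index_mem.
apply: (determinant_alternate (i1 := ord0) (i2 := lift ord0 (Ordinal lt_p))) => //.
by move=> j; rewrite !mxE lift0 /= nth_index.
Qed.

Lemma row_det_sum (I : Type) (r : seq I) (P : pred I) (c : I -> K)
    (p : I -> 'rV[K]_m.+1) q :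
  row_det ((\sum_(i <- r | P i) c i *: p i) :: q)
  = \sum_(i <- r | P i) c i * row_det (p i :: q).
Proof.
have expand p' : row_det (p' :: q) =
    \sum_j p' 0 j * cofactor (\matrix_(i < m.+1) nth 0 (0 :: q) i) 0 j.
  rewrite /row_det (expand_det_row _ ord0); apply: eq_bigr => j _.
  rewrite mxE; congr (_ * (_ * \det _)).
  by apply/matrixP => i1 i2; rewrite !mxE.
rewrite expand; under eq_bigr do rewrite summxE mulr_suml.
rewrite exchange_big /=; apply: eq_bigr => i _.
by rewrite expand mulr_sumr; apply: eq_bigr => j _; rewrite mxE mulrA.
Qed.

Lemma row_det_map_perm (T : eqType) (w : T -> 'rV[K]_m.+1) p (t : m.-tuple T)
    (sigma : 'S_m) :
  row_det (p :: [seq w (tnth t (sigma l)) | l <- enum 'I_m])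
  = (-1) ^+ sigma * row_det (p :: map w t).
Proof.
rewrite (row_det_perm (lift_perm ord0 ord0 sigma) (p :: map w t)).
  by rewrite odd_lift_perm.
move=> i; case: (unliftP ord0 i) => [j ->|->]; last by rewrite lift_perm_id.
rewrite lift_perm_lift !lift0 /= (nth_map j) ?size_enum_ord //.
rewrite nth_ord_enum (nth_map (tnth t j)) ?size_tuple //.
by rewrite -tnth_nth.
Qed.

(** Bringing the row of l to the front is a cycle of length (index l c).+1, realised
here as the lift of the identity permutation that sends 0 to index l c. *)
Lemma row_det_rem (T : eqType) (w : T -> 'rV[K]_m.+1) (l : T) (c s : seq T) :
  l \in c -> size (c ++ s) = m.+1 ->
  row_det (w l :: map w (rem l c ++ s))
  = (-1) ^+ index l c * row_det (map w (c ++ s)).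
Proof.
move=> l_c sz_cs; have lt_l : (index l c < m.+1)%N.
  by rewrite -sz_cs size_cat ltn_addr // index_mem.
rewrite (row_det_perm (lift_perm ord0 (Ordinal lt_l) 1) (map w (c ++ s))).
  by rewrite odd_lift_perm odd_perm1 /= addbF signr_odd.
have lc : (index l c < size c)%N by rewrite index_mem.
have -> : rem l c ++ s = take (index l c) (c ++ s) ++ drop (index l c).+1 (c ++ s).
  rewrite remE -catA takel_cat ?(ltnW lc) // drop_cat; case: ltnP => // le_c.
  have -> : (index l c).+1 = size c by apply/eqP; rewrite eqn_leq lc.
  by rewrite drop_size subnn drop0.
have szt : size (take (index l c) (c ++ s)) = index l c.
  by rewrite size_takel // sz_cs ltnW.
move=> i; case: (unliftP ord0 i) => [j ->|->]; last first.
  by rewrite lift_perm_id /= (nth_map l) ?sz_cs // nth_cat lc nth_index.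
rewrite lift_perm_lift perm1 lift0 /= map_cat nth_cat size_map szt.
rewrite map_take map_drop /bump.
case: ltnP => jl; first by rewrite add0n nth_take.
by rewrite nth_drop addSn subnKC // add1n.
Qed.

End RowDet.

(** * Orderings of independent sets *)

Section Flags.
Context {K : numFieldType} {n k : nat}.
Variable g : 'I_n -> 'Hom('rV[K]_k, K^o).
Implicit Types (A B : indep g) (s t : seq 'I_n).

Lemma lin_indep_perm s t : perm_eq s t -> lin_indep g s = lin_indep g t.
Proof. by move=> st; apply/perm_free/perm_map. Qed.

Lemma lin_indep_uniq s : lin_indep g s -> uniq s.
Proof. by move/free_uniq/map_uniq. Qed.

Lemma indep_free A : lin_indep g (val A).
Proof. by case/andP: (valP A). Qed.

Lemma indep_uniq A : uniq (val A).
Proof. exact/lin_indep_uniq/indep_free. Qed.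

Lemma ltn_ord_trans : transitive [rel i j : 'I_n | (i < j)%N].
Proof. by move=> j i l /=; apply: ltn_trans. Qed.

Lemma ltn_ord_irr : irreflexive [rel i j : 'I_n | (i < j)%N].
Proof. by move=> i /=; rewrite ltnn. Qed.

(** Both sides are increasing, so they are determined by their elements. *)
Lemma indep_filter_inj (P : pred 'I_n) A B :
  [seq i <- val A | P i] =i [seq i <- val B | P i] ->
  [seq i <- val A | P i] = [seq i <- val B | P i].
Proof.
apply: (irr_sorted_eq ltn_ord_trans ltn_ord_irr).
  by apply: sorted_filter; [exact: ltn_ord_trans|case/andP: (valP A)].
by apply: sorted_filter; [exact: ltn_ord_trans|case/andP: (valP B)].
Qed.

Lemma indep_mem_inj A B : val A =i val B -> A = B.
Proof.
move=> AB; apply/val_inj/val_inj.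
apply: (irr_sorted_eq ltn_ord_trans ltn_ord_irr) => //.
  by case/andP: (valP A).
by case/andP: (valP B).
Qed.

Lemma indep_of_seq t : size t = k -> lin_indep g t ->
  exists A, perm_eq t (val A).
Proof.
move=> sz_t free_t.
pose leo := [rel i j : 'I_n | (i <= j)%N]; pose u := sort leo t.
have tu : perm_eq t u by rewrite perm_sym perm_sort.
have sz_u : size u == k by rewrite size_sort sz_t.
have u_ok : sorted [rel i j : 'I_n | (i < j)%N] (Tuple sz_u)
    && lin_indep g (Tuple sz_u).
  rewrite -(lin_indep_perm _ _ tu) free_t andbT /=.
  have -> : sorted [rel i j : 'I_n | (i < j)%N] u = sorted ltn (map val u).
    by rewrite sorted_map.
  rewrite ltn_sorted_uniq_leq (map_inj_uniq val_inj) sort_uniq.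
  rewrite (lin_indep_uniq _ free_t) /= sorted_map.
  exact: (sort_sorted (fun i j : 'I_n => leq_total i j)).
by exists (exist _ (Tuple sz_u) u_ok).
Qed.

Lemma ordering_inj A (sigma tau : 'S_k) :
  [seq tnth (val A) (sigma l) | l <- enum 'I_k]
  = [seq tnth (val A) (tau l) | l <- enum 'I_k] -> sigma = tau.
Proof.
move/eq_in_map => E; apply/permP => l.
by apply: (tuple_uniqP _ (indep_uniq A)); apply: E; rewrite mem_enum.
Qed.

Lemma F_ordering_sign s A (sigma : 'S_k) :
  s = [seq tnth (val A) (sigma l) | l <- enum 'I_k] ->
  F g s A = (-1) ^+ sigma.
Proof.
move=> sE; rewrite ffunE (bigD1 sigma) //= sE eqxx big1 ?addr0 // => tau ne_tau.
by case: eqP => // /esym/ordering_inj E; case/eqP: ne_tau.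
Qed.

Lemma F_ordering s A : perm_eq s (val A) ->
  exists2 sigma : 'S_k, s = [seq tnth (val A) (sigma l) | l <- enum 'I_k]
    & F g s A = (-1) ^+ sigma.
Proof.
case/tuple_permP => sigma sE; exists sigma => //.
exact: F_ordering_sign.
Qed.

Lemma F_eq0 s A : ~~ perm_eq s (val A) -> F g s A = 0.
Proof.
move=> nsA; rewrite ffunE big1 // => sigma _; case: eqP => // sE.
by case/tuple_permP: nsA; exists sigma.
Qed.

Lemma F_indep A B : F g (val A) B = (A == B)%:R.
Proof.
have [<-|neAB] := eqVneq A B.
  rewrite (F_ordering_sign _ _ 1%g) ?odd_perm1 //.
  by rewrite -[LHS]map_tnth_enum; apply: eq_map => l; rewrite perm1.
rewrite F_eq0 //; apply: contraNN neAB => /perm_mem AB.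
by apply/eqP/indep_mem_inj.
Qed.

Variable w : 'I_n -> 'rV[K]_k.+1.

(** Antisymmetry of F and of the wedge product cancel: both pick up the sign of
the ordering. *)
Lemma F_row_det p s A :
  F g s A * row_det (p :: map w s)
  = (perm_eq s (val A))%:R * row_det (p :: map w (val A)).
Proof.
have [sA|nsA] := boolP (perm_eq s (val A)); last by rewrite F_eq0 // !mul0r.
have [sigma sE ->] := F_ordering _ _ sA.
by rewrite sE -map_comp row_det_map_perm mulrA -expr2 sqrr_sign.
Qed.

(** Independent sets are stored increasingly while the exchange terms of L_D are
not; this turns a sum over A into the value at one unsorted list. *)
Lemma row_det_F p t : size t = k -> lin_indep g t ->
  \sum_(A : indep g) F g t A * row_det (p :: map w (val A))
  = row_det (p :: map w t).
Proof.
move=> sz_t free_t; have [A tA] := indep_of_seq _ sz_t free_t.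
rewrite (bigD1 A) //= big1 ?addr0 => [|B neBA].
  have [sigma tE ->] := F_ordering _ _ tA.
  by rewrite tE -map_comp row_det_map_perm.
rewrite F_eq0 ?mul0r //; apply: contraNN neBA => tB.
apply/eqP/indep_mem_inj => i.
by rewrite -(perm_mem tB) (perm_mem tA).
Qed.

End Flags.

(** * Circuits *)

Lemma size_rem_enum_cat {T : finType} (D : {set T}) (i : T) (s : seq T) :
  i \in D -> (size (rem i (enum D) ++ s)).+1 = size (enum D ++ s).
Proof.
move=> i_D; rewrite !size_cat size_rem ?mem_enum // -addSn prednK //.
by rewrite -cardE; apply/card_gt0P; exists i.
Qed.

Section Circuits.
Context {K : numFieldType} {n k : nat}.
Variable g : 'I_n -> 'Hom('rV[K]_k, K^o).
Implicit Types (A B : indep g) (D : {set 'I_n}) (s t : seq 'I_n).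

Lemma lin_indep_rel s (mu : 'I_n -> K) : lin_indep g s ->
  \sum_(i <- s) mu i *: g i = 0 -> forall i, i \in s -> mu i = 0.
Proof.
move=> free_s rel i i_s.
have /(@freeP _ _ _ (in_tuple [seq g j | j <- s])) := free_s.
have lt_i : (index i s < size [seq g j | j <- s])%N by rewrite size_map index_mem.
move=> /(_ (fun j => mu (nth i s j)) _ (Ordinal lt_i)) /=.
rewrite nth_index //; apply.
rewrite -[RHS]rel (big_nth i) big_mkord.
rewrite -(big_mkord xpredT (fun j => mu (nth i s j) *: [seq g j | j <- s]`_j)).
rewrite size_map big_mkord; apply: eq_bigr => j _.
by rewrite (nth_map i).
Qed.

Lemma lin_indep_sub s t : uniq s -> {subset s <= t} ->
  lin_indep g t -> lin_indep g s.
Proof.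
move=> s_uniq st free_t; have t_uniq := lin_indep_uniq _ _ free_t.
suff E : perm_eq t (s ++ [seq i <- t | i \notin s]).
  by move: free_t; rewrite (lin_indep_perm _ _ _ E) /lin_indep map_cat => /catl_free.
apply: uniq_perm => //.
  rewrite cat_uniq s_uniq filter_uniq // andbT.
  by apply/hasPn => i; rewrite mem_filter => /andP[].
move=> i; rewrite mem_cat mem_filter; have [/st ->|] := boolP (i \in s) => //.
Qed.

(** The linear forms live in the dual of a k-dimensional space. *)
Lemma lin_indep_size s : lin_indep g s -> (size s <= k)%N.
Proof.
move/eqP; rewrite size_map => <-.
have := dimvS (subvf <<[seq g i | i <- s]>>%VS).
rewrite dimvf (_ : dim _ = (1 * k * 1)%N) //.
by rewrite mul1n muln1.
Qed.

(** The relation expresses g m through the other elements of D, so the second list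
spans at least what the first one spans; the two have equal length. *)
Lemma lin_indep_exchange D (mu : 'I_n -> K) (l m : 'I_n) s :
  l \in D -> m \in D -> mu m != 0 -> \sum_(i in D) mu i *: g i = 0 ->
  lin_indep g (rem l (enum D) ++ s) -> lin_indep g (rem m (enum D) ++ s).
Proof.
move=> l_D m_D mu_m rel; rewrite /lin_indep /free !size_map => /eqP dim_l.
rewrite eqn_leq; apply/andP; split.
  by rewrite -[leqRHS](size_map g) dim_span.
rewrite -ltnS size_rem_enum_cat // -(size_rem_enum_cat _ l) // -dim_l ltnS.
apply/dimvS/span_subvP => _ /mapP[i i_in ->].
have mem_m j : j \in D -> j != m ->
    g j \in <<[seq g i | i <- rem m (enum D) ++ s]>>%VS.
  move=> j_D jm; apply/memv_span/map_f.
  by rewrite mem_cat mem_rem_uniq ?enum_uniq // inE jm mem_enum j_D.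
have [i_D|i_nD] := boolP (i \in D); last first.
  apply/memv_span/map_f; rewrite mem_cat; apply/orP; right.
  move: i_in; rewrite mem_cat => /orP[/mem_rem|//].
  by rewrite mem_enum (negbTE i_nD).
have [->|] := eqVneq i m; last exact: mem_m.
move/eqP: rel; rewrite (bigD1 m) //= addr_eq0 => /eqP rel.
rewrite -[g m](scalerK mu_m) rel memvZ // memvN.
by apply: memv_suml => j /andP[j_D jm]; rewrite memvZ // mem_m.
Qed.

(** A vanishing coefficient at i would leave a nontrivial relation on D minus i,
against the minimality of D. *)
Lemma circuit_rel_neq0 D (mu : 'I_n -> K) :
  circuit g D -> (exists2 i, i \in D & mu i != 0) ->
  \sum_(i in D) mu i *: g i = 0 -> forall i, i \in D -> mu i != 0.
Proof.
move=> /andP[_ /forall_inP min_D] [j j_D mu_j] rel i i_D.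
apply: contraNneq mu_j => mu_i.
have [->|ji] := eqVneq j i; first by rewrite mu_i.
have := min_D _ (properD1 i_D) => /lin_indep_rel -> //; last first.
  by rewrite mem_enum !inE ji.
rewrite -[RHS]rel big_enum /= [RHS](big_setD1 i) //= mu_i scale0r add0r.
exact: eq_bigl.
Qed.

(** The k + 1 elements of B and l are dependent; a minimal dependent subset of them
is a circuit, and it contains l since B is independent. *)
Lemma fundamental_circuit B (l : 'I_n) : l \notin val B ->
  exists D, [&& circuit g D, l \in D & D :\ l \subset val B].
Proof.
move=> l_nB; pose X := l |: [set i in val B].
have X_dep : ~~ lin_indep g (enum X).
  apply/negP => /lin_indep_size; rewrite -cardE cardsU1 inE l_nB.
  by rewrite cardsE (card_uniqP (indep_uniq _ B)) size_tuple ltnn.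
have [D /minsetP[D_dep D_min] DX] 
  := minset_exists (P := fun D' => ~~ lin_indep g (enum D')) X_dep.
have DlB : D :\ l \subset val B.
  apply/fintype.subsetP => i; rewrite !inE => /andP[il /(fintype.subsetP DX)].
  by rewrite !inE (negbTE il).
exists D; rewrite DlB andbT; apply/andP; split.
  apply/andP; split=> //; apply/forall_inP => D' /andP[D'D /negP nDD'].
  by apply/negPn/negP => /D_min/(_ D'D) E; case: nDD'; rewrite E.
apply: contraNT D_dep => l_nD.
apply: (lin_indep_sub _ (val B)); rewrite ?enum_uniq ?indep_free //.
move=> i; rewrite mem_enum => i_D; apply: (fintype.subsetP DlB).
by rewrite !inE i_D andbT; apply: contraNneq l_nD => <-.
Qed.

(** Eliminating l between the relations of the two circuits gives a relation on B,
which is trivial; hence the relations are proportional and have the same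
support, which for each of them is the whole circuit. *)
Lemma fundamental_circuit_uniq B (l : 'I_n) D1 D2 (mu : {set 'I_n} -> 'I_n -> K) :
  (forall D, circuit g D -> exists2 i, i \in D & mu D i != 0) ->
  (forall D, circuit g D -> \sum_(i in D) mu D i *: g i = 0) ->
  [&& circuit g D1, l \in D1 & D1 :\ l \subset val B] ->
  [&& circuit g D2, l \in D2 & D2 :\ l \subset val B] -> D1 = D2.
Proof.
move=> mu_neq0 mu_rel /and3P[D1_c l_D1 D1B] /and3P[D2_c l_D2 D2B].
pose e D i := if i \in D then mu D i else 0.
have e_neq0 D i : circuit g D -> (e D i != 0) = (i \in D).
  move=> Dc; rewrite /e; case: ifP => // i_D; last by rewrite eqxx.
  exact: (circuit_rel_neq0 _ _ Dc (mu_neq0 _ Dc) (mu_rel _ Dc)).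
have e_rel D : circuit g D -> \sum_i e D i *: g i = 0.
  move=> Dc; rewrite -[RHS](mu_rel _ Dc) [RHS]big_mkcond /=.
  by apply: eq_bigr => i _; rewrite /e; case: ifP => //; rewrite scale0r.
pose nu i := e D2 l * e D1 i - e D1 l * e D2 i.
have nu0 i : i \notin val B -> nu i = 0.
  move=> i_nB; rewrite /nu; have [->|il] := eqVneq i l; first by rewrite mulrC subrr.
  have out D : D :\ l \subset val B -> e D i = 0.
    move=> /fintype.subsetP/(_ i); rewrite !inE il /= /e.
    by case: ifP => // _ /(_ isT); rewrite (negbTE i_nB).
  by rewrite !out // !mulr0 subrr.
have nu_all i : nu i = 0.
  have [i_B|/nu0//] := boolP (i \in val B).
  apply: (lin_indep_rel _ _ (indep_free _ B)) i_B.
  rewrite big_uniq ?indep_uniq //=.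
  transitivity (\sum_i nu i *: g i).
    rewrite [RHS](bigID (mem (val B))) /= [X in _ + X]big1 ?addr0 // => j j_nB.
    by rewrite nu0 ?scale0r.
  under eq_bigr do rewrite scalerBl -!scalerA.
  by rewrite sumrB -!scaler_sumr !e_rel // !scaler0 subrr.
apply/setP => i; rewrite -!e_neq0 //.
have := nu_all i; rewrite /nu => /eqP; rewrite subr_eq0 => /eqP E.
have E1 : e D1 l != 0 by rewrite e_neq0.
have E2 : e D2 l != 0 by rewrite e_neq0.
by have := congr1 (fun z => z != 0) E; rewrite /= !mulf_eq0 (negbTE E1) (negbTE E2).
Qed.

(** Identifies the l for which exchanging inside D can produce the basis vector
of B. *)
Lemma replaced_perm D B (l : 'I_n) : l \in D ->
  perm_eq (rem l (enum D) ++ [seq i <- val B | i \notin D]) (val B)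
  = (l \notin val B) && (D :\ l \subset val B).
Proof.
move=> l_D; have rem_mem i : (i \in rem l (enum D)) = (i != l) && (i \in D).
  by rewrite mem_rem_uniq ?enum_uniq // inE mem_enum.
apply/idP/andP => [/perm_mem E|[l_nB /fintype.subsetP DlB]].
  split; first by rewrite -E mem_cat rem_mem eqxx mem_filter l_D.
  by apply/fintype.subsetP => i; rewrite !inE -E mem_cat rem_mem => ->.
apply: uniq_perm; last 2 first.
- exact: indep_uniq.
- move=> i; rewrite mem_cat rem_mem mem_filter.
  have [->|il] := eqVneq i l; first by rewrite l_D (negbTE l_nB).
  have [i_D|//] := boolP (i \in D).
  by rewrite (DlB i) // !inE il.
rewrite cat_uniq rem_uniq ?enum_uniq // filter_uniq ?indep_uniq // andbT.
apply/hasPn => i; rewrite mem_filter rem_mem => /andP[i_D _].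
by rewrite (negbTE i_D) andbF.
Qed.

End Circuits.

(** * The contribution of one circuit *)

Section Coefficients.
Context {K : numFieldType} {n k : nat}.
Variable g : 'I_n -> 'Hom('rV[K]_k, K^o).
Implicit Types (A B : indep g) (D : {set 'I_n}).

Local Notation rest D A := [seq i <- val A | i \notin D].

(** Exchanging an element of D for another one does not touch the elements outside
D. *)
Lemma rest_replaced D A B (m : 'I_n) :
  perm_eq (rem m (enum D) ++ rest D A) (val B) -> rest D A = rest D B.
Proof.
move=> /perm_mem E; apply: indep_filter_inj => i; rewrite !mem_filter.
have [//|i_nD /=] := boolP (i \in D).
rewrite -E mem_cat mem_filter i_nD /=; case: (boolP (i \in rem _ _)) => //.
by move/mem_rem; rewrite mem_enum (negbTE i_nD).
Qed.

(** When the coordinate of F along A is nonzero, A contains D minus m but not m.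
So this coordinate vanishes outside the cases that L_D singles out, and the
coefficient is a plain double sum over D, which commutes with sums over A. *)
Lemma Lbasis_coef (a : 'I_n -> K) D A B :
  Lbasis a D A B =
  \sum_(m in D) \sum_(l in D)
     (-1) ^+ index m (enum D) * F g (rem m (enum D) ++ rest D A) A *
     ((-1) ^+ index l (enum D) * a l * F g (rem l (enum D) ++ rest D A) B).
Proof.
have F0 m : m \in D ->
    (#|[set i in val A | i \in D]| < #|D|.-1)%N || (m \in val A) ->
    F g (rem m (enum D) ++ rest D A) A = 0.
  move=> m_D bad; apply: F_eq0; apply: contraTN bad.
  rewrite replaced_perm // => /andP[m_nA DmA].
  rewrite negb_or m_nA andbT -leqNgt.
  have := cardsD1 m D; rewrite m_D add1n => ->; apply: subset_leq_card.
  apply/fintype.subsetP => i i_in; rewrite inE (fintype.subsetP DmA) //.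
  by move: i_in; rewrite !inE => /andP[].
rewrite /Lbasis; case: ifP => [few|many].
  rewrite ffunE big1 // => m m_D; rewrite big1 // => l _.
  by rewrite F0 ?few // mulr0 mul0r.
rewrite sum_ffunE [RHS](bigID (fun m => m \notin val A)) /=.
rewrite [X in _ = _ + X]big1 ?addr0 => [|m /andP[m_D /negPn m_A]]; last first.
  by rewrite big1 // => l _; rewrite F0 ?m_A ?orbT // mulr0 mul0r.
apply: eq_bigr => m _; rewrite !ffunE sum_ffunE scalerA scaler_sumr.
apply: eq_bigr => l _; rewrite ffunE -mulrA [RHS]mulrCA.
by rewrite -[_ *: _]mulrA.
Qed.

Variable w : 'I_n -> 'rV[K]_k.+1.

(** In the term of index m only the summand c m *: w m survives, every other w i
being repeated; moving w m back to its place yields the sign that the term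
carries. *)
Lemma row_det_circuit D (c : 'I_n -> K) (s : seq 'I_n) :
  size (enum D ++ s) = k.+1 -> \sum_(i in D) c i = 1 ->
  \sum_(m in D) (-1) ^+ index m (enum D)
     * row_det ((\sum_(i in D) c i *: w i) :: map w (rem m (enum D) ++ s))
  = row_det (map w (enum D ++ s)).
Proof.
move=> sz_Ds c1; rewrite -[RHS]mul1r -[X in _ = X * _]c1 mulr_suml.
apply: eq_bigr => m m_D.
rewrite row_det_sum (bigD1 m) //= row_det_rem ?mem_enum //.
rewrite big1 ?addr0 => [|i /andP[i_D im]].
  by rewrite mulrCA signrMK.
rewrite row_det_dup ?mulr0 //.
  by rewrite size_map -ltnS size_rem_enum_cat // sz_Ds.
apply: map_f; rewrite mem_cat mem_rem_uniq ?enum_uniq // inE im.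
by rewrite mem_enum i_D.
Qed.

(** Here w stands for the values of the forms omega_i and the combination with
coefficients c for that of omega_D; mu is the relation of the circuit. For
fixed l, the sum over A produces the wedge product along D minus m and the rest
of B, and the sum over m is then evaluated by row_det_circuit. *)
Lemma circuit_contribution D B (a c mu : 'I_n -> K) :
  \sum_(i in D) c i = 1 ->
  (forall i, i \in D -> mu i != 0) -> \sum_(i in D) mu i *: g i = 0 ->
  \sum_(A : indep g)
     row_det ((\sum_(i in D) c i *: w i) :: map w (val A)) * Lbasis a D A B
  = \sum_(l in D | (l \notin val B) && (D :\ l \subset val B))
       a l * row_det (w l :: map w (val B)).
Proof.
move=> c1 mu_neq0 mu_rel; set p := \sum_(i in D) _.
transitivity (\sum_(l in D) (-1) ^+ index l (enum D) * a l
    * F g (rem l (enum D) ++ rest D B) B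
    * \sum_(m in D) (-1) ^+ index m (enum D)
    * \sum_(A : indep g) F g (rem m (enum D) ++ rest D B) A
        * row_det (p :: map w (val A))).
  under eq_bigr do rewrite Lbasis_coef mulr_sumr.
  rewrite exchange_big /=.
  under eq_bigr do under eq_bigr do rewrite mulr_sumr.
  under eq_bigr do rewrite exchange_big /=.
  rewrite exchange_big /=; apply: eq_bigr => l l_D.
  rewrite mulr_sumr; apply: eq_bigr => m m_D.
  rewrite !mulr_sumr; apply: eq_bigr => A _.
  (* All terms with rest D A <> rest D B vanish, so A may be replaced by B in
     the lists; afterwards A occurs only in one coordinate of F. *)
  have swap : F g (rem m (enum D) ++ rest D A) A
                * F g (rem l (enum D) ++ rest D A) B
            = F g (rem m (enum D) ++ rest D B) A
                * F g (rem l (enum D) ++ rest D B) B.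
    have [-> //|neAB] := eqVneq (rest D A) (rest D B).
    rewrite [in LHS](F_eq0 _ _ B) ?mulr0.
      rewrite [in RHS](F_eq0 _ _ A) ?mul0r //.
      by apply: contraNN neAB => /rest_replaced->.
    by apply: contraNN neAB => /rest_replaced->.
  rewrite !mulrA; set sm := _ ^+ _; set sl := _ ^+ _.
  rewrite (_ : _ * F g _ B = row_det (p :: map w (val A)) * sm * sl * a l
    * (F g (rem m (enum D) ++ rest D A) A * F g (rem l (enum D) ++ rest D A) B)).
    rewrite swap; ring.
  ring.
rewrite [RHS]big_mkcondr; apply: eq_bigr => l l_D.
rewrite -replaced_perm //; case: ifP => [lB|/negbT nlB]; last first.
  by rewrite (F_eq0 _ _ _ nlB) mulr0 mul0r.
have sz_l : size (rem l (enum D) ++ rest D B) = k.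
  by rewrite (perm_size lB) size_tuple.
have sz_D : size (enum D ++ rest D B) = k.+1.
  by rewrite -(size_rem_enum_cat _ l) // sz_l.
have free_l : lin_indep g (rem l (enum D) ++ rest D B).
  by rewrite (lin_indep_perm _ _ _ lB) indep_free.
under eq_bigr => m m_D.
  rewrite row_det_F; [over| |]; last first.
    by apply: (lin_indep_exchange _ _ mu l) free_l => //; exact: mu_neq0.
  by apply/eq_add_S; rewrite size_rem_enum_cat.
have := row_det_rem _ w l (enum D) (rest D B).
rewrite mem_enum => /(_ l_D sz_D) det_l.
have := F_row_det g w (w l) (rem l (enum D) ++ rest D B) B.
rewrite lB mul1r det_l => <-.
by rewrite row_det_circuit //; ring.
Qed.

End Coefficients.

(** * The logarithmic forms *)

Section LinearForms.
Context {K : numFieldType} {n k : nat}.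
Local Notation E := ('rV[K]_n * 'rV[K]_k)%type.
Variable g : 'I_n -> 'Hom('rV[K]_k, K^o).

Lemma dlog_linear (f : {linear E -> K^o}) (x u : E) :
  continuous f -> dlog f x u = (f x)^-1 * f u.
Proof. by move=> f_cont; rewrite /dlog diff_lin. Qed.

Lemma continuous_coord1 (j : 'I_n) : continuous (fun x : E => x.1 0 j : K^o).
Proof.
move=> x; apply: (@continuous_comp _ _ _ fst (fun M : 'rV[K]_n => M 0 j : K^o)).
  exact: cvg_fst.
exact: coord_continuous.
Qed.

Lemma continuous_lin_comb (I : Type) (r : seq I) (P : pred I) (c : I -> K)
    (f : I -> E -> K^o) : (forall i, continuous (f i)) ->
  continuous (fun x => \sum_(i <- r | P i) c i * f i x : K^o).
Proof.
move=> f_cont; apply: (continuous_big (P := P)).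
  exact: (@pseudometric_normed_Zmodule.add_continuous K K^o).
by move=> i _ x; apply: cvgMl_tmp; exact: f_cont.
Qed.

Lemma continuous_functional (h : 'Hom('rV[K]_k, K^o)) :
  continuous (fun x : E => h x.2).
Proof.
have -> : (fun x : E => h x.2) = fun x : E => \sum_(i < k) h (delta_mx 0 i) * x.2 0 i.
  apply/funext => x; rewrite {1}[x.2]row_sum_delta linear_sum.
  by apply: eq_bigr => i _; rewrite linearZ mulrC.
apply: continuous_lin_comb => i x.
apply: (@continuous_comp _ _ _ snd (fun M : 'rV[K]_k => M 0 i : K^o)).
  exact: cvg_snd.
exact: coord_continuous.
Qed.

Fact ff_is_linear (j : 'I_n) : linear (ff g j).
Proof.
move=> c x y; rewrite /ff /= linearP !mxE scalerDr.
by rewrite addrACA.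
Qed.

HB.instance Definition _ (j : 'I_n) :=
  GRing.isLinear.Build K E K^o *:%R (ff g j) (ff_is_linear j).

Fact fcirc_is_linear (D : {set 'I_n}) (l : 'I_n -> K) :
  linear (fcirc (k := k) D l).
Proof.
move=> c x y; rewrite /fcirc scaler_sumr -big_split /=.
by apply: eq_bigr => i _; rewrite !mxE mulrDr [c *: _]mulrCA.
Qed.

HB.instance Definition _ (D : {set 'I_n}) (l : 'I_n -> K) :=
  GRing.isLinear.Build K E K^o *:%R (fcirc (k := k) D l) (fcirc_is_linear D l).

Lemma omegaE (j : 'I_n) (x u : E) : omega g j x u = (ff g j x)^-1 * ff g j u.
Proof.
apply: dlog_linear => y; apply: cvgD; first exact: continuous_coord1.
exact: continuous_functional.
Qed.

Lemma omegacE (D : {set 'I_n}) (l : 'I_n -> K) (x u : E) :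
  omegac D l x u = (fcirc D l x)^-1 * fcirc D l u.
Proof.
by apply: dlog_linear; apply: continuous_lin_comb => i; exact: continuous_coord1.
Qed.

(** The terms in t cancel by the relation. *)
Lemma fcirc_ff (D : {set 'I_n}) (l : 'I_n -> K) (x : E) :
  \sum_(i in D) l i *: g i = 0 ->
  fcirc D l x = \sum_(i in D) l i * ff g i x.
Proof.
move=> rel; rewrite /ff; under [RHS]eq_bigr do rewrite mulrDr.
rewrite big_split /= [X in _ = _ + X](_ : _ = 0) ?addr0 //.
have := congr1 (fun h : 'Hom('rV[K]_k, K^o) => h x.2) rel.
rewrite sum_lfunE zero_lfunE => rel_x; rewrite -[RHS]rel_x.
by apply: eq_bigr => i _; rewrite scale_lfunE.
Qed.

(** By fcirc_ff applied at x, the coefficients of this combination sum to 1. *)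
Lemma omegac_omega (D : {set 'I_n}) (l : 'I_n -> K) (x u : E) :
  (forall j, ff g j x != 0) -> \sum_(i in D) l i *: g i = 0 ->
  omegac D l x u
  = \sum_(i in D) (l i * ff g i x / fcirc D l x) * omega g i x u.
Proof.
move=> x_reg rel; rewrite omegacE (fcirc_ff _ _ u rel) mulr_sumr.
apply: eq_bigr => i _; rewrite omegaE; have := x_reg i.
move: (fcirc D l x)^-1 => z nz; by field.
Qed.

Lemma wedge_omega_det (theta : form1 E) (A : indep g) (x : E) (v : 'I_k.+1 -> E) :
  wedge_omega theta A x v
  = row_det ((\row_c theta x (v c))
             :: [seq \row_c omega g j x (v c) | j <- val A]).
Proof.
congr (\det _); apply/matrixP => i c; rewrite !mxE (tnth_nth theta) /=.
case: i => -[|i] lt_i /=; first by rewrite mxE.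
have j := tnth (val A) (Ordinal (lt_i : (i < k)%N)).
by rewrite !(nth_map j) ?size_tuple // mxE.
Qed.

End LinearForms.

(** * The identity *)

(** For fixed B, exchanging the sum over the circuits D with the sum over l in D
leaves, for each l outside B, the fundamental circuit of l and B alone. *)
Lemma circuit_form_identity (K : numFieldType) (n k : nat)
  (g : 'I_n -> 'Hom('rV[K]_k, K^o)) (a : 'I_n -> K)
  (lam : {set 'I_n} -> 'I_n -> K)
  (lam_neq0 : forall D : {set 'I_n}, circuit g D ->
     exists2 i : 'I_n, i \in D & lam D i != 0)
  (lam_rel : forall D : {set 'I_n}, circuit g D ->
     \sum_(i in D) lam D i *: g i = 0)
  (x : 'rV[K]_n * 'rV[K]_k)
  (hx : forall j : 'I_n, ff g j x != 0)
  (hxc : forall D : {set 'I_n}, circuit g D -> fcirc D (lam D) x != 0)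
  (v : 'I_k.+1 -> 'rV[K]_n * 'rV[K]_k) :
  \sum_(A : indep g)
    tensor (wedge_omega (omega_a g a) A) (F g (val A)) x v
  = \sum_(A : indep g) \sum_(D : {set 'I_n} | circuit g D)
      tensor (wedge_omega (omegac D (lam D)) A) (L a D (F g (val A))) x v.
Proof.
pose w j : 'rV[K]_k.+1 := \row_c omega g j x (v c).
pose b D i := lam D i * ff g i x / fcirc D (lam D) x.
have LF D (A : indep g) : L a D (F g (val A)) = Lbasis a D A.
  rewrite /L (bigD1 A) //= F_indep eqxx scale1r big1 ?addr0 // => A' neA.
  by rewrite F_indep eq_sym (negbTE neA) scale0r.
have wa (A : indep g) : wedge_omega (omega_a g a) A x v
    = \sum_j a j * row_det (w j :: map w (val A)).
  rewrite wedge_omega_det -row_det_sum; congr (row_det (_ :: _)).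
  by apply/rowP => c; rewrite !mxE summxE; apply: eq_bigr => j _; rewrite !mxE.
have wc D (A : indep g) : circuit g D -> wedge_omega (omegac D (lam D)) A x v
    = row_det ((\sum_(i in D) b D i *: w i) :: map w (val A)).
  move=> Dc; rewrite wedge_omega_det; congr (row_det (_ :: _)).
  apply/rowP => c; rewrite !mxE summxE (omegac_omega g) ?lam_rel //.
  by apply: eq_bigr => j _; rewrite !mxE.
have b1 D : circuit g D -> \sum_(i in D) b D i = 1.
  by move=> Dc; rewrite -mulr_suml -fcirc_ff ?lam_rel // divff ?hxc.
apply/ffunP => B; rewrite !sum_ffunE.
transitivity (\sum_l a l * row_det (w l :: map w (val B))).
  rewrite (bigD1 B) //= [X in _ + X]big1 ?addr0 => [|A neA].
    by rewrite /tensor ffunE F_indep eqxx wa [LHS]mulr1.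
  by rewrite /tensor ffunE F_indep (negbTE neA) [LHS]mulr0.
under [RHS]eq_bigr do rewrite sum_ffunE.
rewrite exchange_big /=.
transitivity (\sum_(D | circuit g D)
    \sum_(l in D | (l \notin val B) && (D :\ l \subset val B))
      a l * row_det (w l :: map w (val B))); last first.
  apply: eq_bigr => D Dc.
  rewrite -(circuit_contribution _ w _ _ a (b D) (lam D)) ?b1 ?lam_rel //; last first.
    exact: (circuit_rel_neq0 _ _ _ Dc (lam_neq0 _ Dc) (lam_rel _ Dc)).
  by apply: eq_bigr => A _; rewrite /tensor ffunE LF wc.
rewrite (exchange_big_dep xpredT) //=; apply: eq_bigr => l _.
have [l_B|l_nB] := boolP (l \in val B).
  rewrite row_det_dup ?mulr0 ?size_map ?size_tuple //; last exact: map_f.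
  by rewrite big1.
have [D0 D0P] := fundamental_circuit g _ _ l_nB.
rewrite (big_pred1 D0) // => D /=; apply/idP/eqP => [DP|->]; last exact: D0P.
exact: (fundamental_circuit_uniq _ _ _ _ _ _ lam_neq0 lam_rel DP D0P).
Qed.

Theorem lemma5p4 (R : realType) (n k : nat) (hk : (0 < k)%N) (hkn : (k < n)%N)
  (g : 'I_n -> 'Hom('rV[R[i]]_k, R[i]^o))
  (g_neq0 : forall j : 'I_n, g j != 0)
  (g_span : (<<[seq g j | j <- enum 'I_n]>> = fullv)%VS)
  (a : 'I_n -> R[i]) (a_neq0 : forall j : 'I_n, a j != 0)
  (lam : {set 'I_n} -> 'I_n -> R[i])
  (lam_neq0 : forall D : {set 'I_n}, circuit g D ->
     exists2 i : 'I_n, i \in D & lam D i != 0)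
  (lam_rel : forall D : {set 'I_n}, circuit g D ->
     \sum_(i in D) lam D i *: g i = 0)
  (x : 'rV[R[i]]_n * 'rV[R[i]]_k)
  (hx : forall j : 'I_n, ff g j x != 0)
  (hxc : forall D : {set 'I_n}, circuit g D -> fcirc D (lam D) x != 0)
  (v : 'I_k.+1 -> 'rV[R[i]]_n * 'rV[R[i]]_k) :
  \sum_(A : indep g)
    tensor (wedge_omega (omega_a g a) A) (F g (val A)) x v
  = \sum_(A : indep g) \sum_(D : {set 'I_n} | circuit g D)
      tensor (wedge_omega (omegac D (lam D)) A) (L a D (F g (val A))) x v.
Proof. exact: circuit_form_identity. Qed.
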